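(* Consider a stationary VLMC defined by a probabilized infinite comb with data $q_{0^\infty}$, $q_{0^n1}$ ($n\ge0$) and stationary probability measure $\pi$. Let $c_0=1$, $c_n=\prod_{k=0}^{n-1}q_{0^k1}(0)$ for $n\ge1$; suppose that $\sum c_n$ converges and let $$S(1)=\sum_{n\ge0}c_n,\qquad R_n=\sum_{k\ge n}c_k\quad(n\ge0).$$ Then the Dirichlet series $\Lambda(s)=\sum_{w\in\mathcal W}\pi(w)^s$ of the source is given, at every complex $s$ with $\Re(s)>0$ at which it converges absolutely, by $$\Lambda(s)=\frac1{S(1)^s}\left[\sum_{n\ge0}R_n^s+\frac{\left(\sum_{n\ge0}c_n^s\right)^2}{1-\sum_{n\ge0}(c_n-c_{n+1})^s}\right].$$
   Context: **Words.** $\mathcal A=\{0,1\}$; $\mathcal W$ is the set of all finite words over $\mathcal A$ (including the empty word $\emptyset$); $\mathcal L=\mathcal A^{-\mathbb N}$ is the set of left-infinite sequences $\cdots\alpha_{-1}\alpha_0$, with the $\sigma$-algebra generated by the cylinders $\mathcal Lw=\{s\in\mathcal L:\ w\text{ is a suffix of }s\}$, $w\in\mathcal W$. For $s=\cdots\alpha_{-1}\alpha_0\in\mathcal L$, $\overline s=\alpha_0\alpha_{-1}\cdots$. Notation: $\pi(w):=\pi(\mathcal Lw)$, so $\pi(\emptyset)=1$. **Infinite comb.** It is the tree $\{0^n:n\ge0\}\cup\{0^n1:n\ge0\}$, whose leaves (contexts) are the finite words $0^n1$, $n\ge0$, and the infinite word $0^\infty=000\cdots$; to each context $c$ is attached a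 probability measure $q_c$ on $\mathcal A$. **VLMC.** For $s\in\mathcal L$, $\mathrm{pref}(s)$ is the unique context that is a prefix of $\overline s$ (or equals $\overline s$). The VLMC is the $\mathcal L$-valued Markov chain $(U_n)$ with transitions $\mathbf P(U_{n+1}=U_n\alpha\mid U_n)=q_{\mathrm{pref}(U_n)}(\alpha)$; it is stationary when $U_0$ has a stationary distribution $\pi$. **Convention.** $x^s=e^{s\log x}$ for $x>0$ and $0^s=0$. *)

(* Defs.v *)
From HB Require Import structures.
From mathcomp Require Import all_boot all_order all_algebra.
From mathcomp Require Import complex.
From mathcomp Require Import all_classical all_reals all_analysis.
From mathcomp Require Import measurable_realfun.
From mathcomp Require summability.

Set Implicit Arguments.
Unset Strict Implicit.
Unset Printing Implicit Defensive.

Import Order.TTheory GRing.Theory Num.Theory.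
Import numFieldNormedType.Exports.

Local Open Scope classical_set_scope.
Local Open Scope ring_scope.
Local Open Scope complex_scope.

(* The letters 0 and 1 are false and true; a word is a seq bool, in reading
   order.  A left-infinite sequence ... s_{-1} s_0 is encoded by the function
   k |-> s_{-k}, so that as a function it reads as the reversed sequence. *)

(* the sequences that have w as a suffix *)
Definition cyl (w : seq bool) : set (nat -> bool) :=
  [set s | rev (mkseq s (size w)) = w].

Definition cylinders : set (set (nat -> bool)) := range cyl.

Definition leftseq := g_sigma_algebraType cylinders.

HB.instance Definition _ := Measurable.on leftseq.

Lemma measurable_cyl w : measurable (cyl w : set leftseq).
Proof. by apply: sub_sigma_algebra; exists w. Qed.

Definition append (s : leftseq) (a : bool) : leftseq :=
  fun k => if k is j.+1 then s j else a.

Lemma measurable_append s : measurable_fun [set: bool] (append s).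
Proof. by []. Qed.

HB.instance Definition _ s :=
  isMeasurableFun.Build _ _ _ _ (append s) (measurable_append s).

Lemma measurable_append_l a : measurable_fun [set: leftseq] (append ^~ a).
Proof.
apply: (@measurability _ _ leftseq leftseq _ _ cylinders) => //.
move=> _ [_ [w _ <-] <-]; rewrite setTI.
case: (lastP w) => [|w' b].
  by rewrite (_ : _ @^-1` _ = setT)//; apply/seteqP.
have E s : rev (mkseq (append s a) (size w').+1)
         = rcons (rev (mkseq s (size w'))) a.
  by rewrite -rev_cons /mkseq/= -[1%N]addn0 iotaDl -map_comp.
have [<-|ab] := eqVneq a b.
- rewrite (_ : _ @^-1` _ = cyl w'); first exact: measurable_cyl.
  apply/seteqP; split => s; rewrite /preimage /cyl /mkset size_rcons E.
  + by move/rcons_inj => -[].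
  + by move=> ->.
- rewrite (_ : _ @^-1` _ = set0); first exact: measurable0.
  apply/seteqP; split => s //; rewrite /preimage /cyl /mkset size_rcons E.
  by move/rcons_inj => -[_ /eqP]; rewrite (negbTE ab).
Qed.

(* CtxFin n is the word 0^n 1, CtxInf is the infinite word 000... *)
Inductive comb_context := CtxFin of nat | CtxInf.

HB.instance Definition _ := gen_eqMixin comb_context.
HB.instance Definition _ := gen_choiceMixin comb_context.

(* c is a prefix of (or equal to) the reversal of s *)
Definition ctx_prefix (c : comb_context) (s : leftseq) : Prop :=
  match c with
  | CtxFin n => mkseq s n.+1 = rcons (nseq n false) true
  | CtxInf => forall k, s k = false
  end.

Definition pref (s : leftseq) : comb_context :=
  xget CtxInf [set c | ctx_prefix c s].

Lemma ctx_prefixE n s :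
  ctx_prefix (CtxFin n) s <-> (forall k, (k < n)%N -> s k = false) /\ s n.
Proof.
rewrite /ctx_prefix /mkseq -addn1 iotaD map_cat/= add0n cats1.
split.
  move/rcons_inj => -[h ->]; split => // k kn.
  have := congr1 (nth false ^~ k) h.
  by rewrite nth_nseq kn (nth_map 0%N) ?size_iota// nth_iota.
move=> [h ->]; congr rcons.
apply: (@eq_from_nth _ false); first by rewrite size_map size_iota size_nseq.
move=> k; rewrite size_map size_iota => kn.
by rewrite nth_nseq kn (nth_map 0%N) ?size_iota// nth_iota// h.
Qed.

Lemma ctx_prefix_inj c c' s : ctx_prefix c s -> ctx_prefix c' s -> c = c'.
Proof.
case: c c' => [n|] [m|] //.
- move=> /ctx_prefixE[hn sn] /ctx_prefixE[hm sm]; congr CtxFin.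
  by case: (ltngtP n m) => // [/hm|/hn] h; [rewrite h in sn|rewrite h in sm].
- by move=> /ctx_prefixE[_ sn] h; rewrite (h n) in sn.
- by move=> h /ctx_prefixE[_ sm]; rewrite (h m) in sm.
Qed.

Lemma ctx_prefix_ex s : exists c, ctx_prefix c s.
Proof.
have [h|] := pselect (exists n, s n).
  exists (CtxFin (ex_minn h)); apply/ctx_prefixE; case: ex_minnP => m sm mP.
  by split => // k; apply: contraTF => /mP; rewrite -leqNgt.
by move=> h; exists CtxInf => k; apply/negP => sk; apply: h; exists k.
Qed.

Lemma prefP c s : pref s = c <-> ctx_prefix c s.
Proof.
have h : ctx_prefix (pref s) s.
  by rewrite /pref; case: xgetP => //= n0; case: (ctx_prefix_ex s) => c' /n0.
by split=> [<-//|h']; exact: ctx_prefix_inj h h'.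
Qed.

Lemma measurable_pref c : measurable (pref @^-1` [set c]).
Proof.
have mF n : measurable (pref @^-1` [set CtxFin n]).
  rewrite (_ : _ @^-1` _ = cyl (rev (rcons (nseq n false) true))).
    exact: measurable_cyl.
  apply/seteqP; split => s /=; rewrite /cyl/= size_rev size_rcons size_nseq.
    by move/prefP => /= ->.
  by move=> h; apply/prefP; apply: (can_inj (@revK _)).
case: c => // ; rewrite (_ : _ @^-1` _ =
    ~` \bigcup_n (pref @^-1` [set CtxFin n])); last first.
  apply/seteqP; split => s /=; first by move=> sE [n _ /=]; rewrite sE.
  by move=> h; case E : (pref s) => [n|]//; case: h; exists n.
by apply: measurableC; exact: bigcup_measurable.
Qed.

Section comb.
Variables (R : realType) (q : comb_context -> probability bool R).

(* The law of the successor of s, that is of s followed by a letter drawn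
   from q (pref s). *)
Definition comb_trans (s : leftseq) : {measure set leftseq -> \bar R} :=
  distribution (q (pref s)) (append s).

Lemma measurable_fun_pref (g : comb_context -> \bar R) :
  measurable_fun [set: leftseq] (g \o pref).
Proof.
move=> _ Y mY; rewrite setTI.
rewrite (_ : _ @^-1` _ =
  (\bigcup_(n in [set n | Y (g (CtxFin n))]) (pref @^-1` [set CtxFin n])) `|`
  (\bigcup_(_ in [set _ : nat | Y (g CtxInf)]) (pref @^-1` [set CtxInf]))).
  by apply: measurableU; apply: bigcup_measurable => n _; exact: measurable_pref.
apply/seteqP; split => s /=.
  case E : (pref s) => [n|] h; [left|right]; first by exists n.
  by exists 0%N.
by move=> [[n /= h ->]|[n /= h ->]].
Qed.

Lemma measurable_comb_trans U : measurable U ->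
  measurable_fun [set: leftseq] (comb_trans ^~ U).
Proof.
move=> mU.
pose g a s := ((\1_U (append s a))%:E * q (pref s) [set a])%E.
have mg a : measurable_fun [set: leftseq] (g a).
  apply: emeasurable_funM; last exact: (measurable_fun_pref (q ^~ [set a])).
  apply/measurable_EFinP.
  apply: (measurableT_comp (f := (\1_U : leftseq -> R))) (measurable_append_l a).
  exact: measurable_indic.
rewrite (_ : (fun s => _) = (fun s => g false s + g true s)%E).
  exact: emeasurable_funD.
apply/funext => s; rewrite /comb_trans/= /distribution /pushforward/=.
set A := append s @^-1` U.
have -> : A = (A `&` [set false]) `|` (A `&` [set true]).
  rewrite -setIUr (_ : _ `|` _ = setT) ?setIT//.
  by apply/seteqP; split => -[] // _; [right|left].
rewrite measureU//; last by apply/seteqP; split => // -[] [[_ ?] [_ ?]].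
suff E a : q (pref s) (A `&` [set a]) = g a s by congr adde; exact: E.
rewrite /g indicE; have [Ua|Ua] := boolP (append s a \in U).
  by rewrite mul1e; congr (q _ _); apply/setIidPr => _ ->; exact: set_mem.
rewrite mul0e (_ : _ `&` _ = set0) ?measure0//.
apply/seteqP; split => // b [Ab /= ba]; move: Ab; rewrite ba => Aa.
by case/negP: Ua; exact: mem_set Aa.
Qed.

HB.instance Definition _ :=
  isKernel.Build _ _ _ _ _ comb_trans measurable_comb_trans.

Lemma comb_trans_prob s : comb_trans s [set: leftseq] = 1%E.
Proof. exact: probability_setT. Qed.

HB.instance Definition _ :=
  Kernel_isProbability.Build _ _ _ _ _ comb_trans comb_trans_prob.

Definition stationary (pi : probability leftseq R) : Prop :=
  forall A : set leftseq, measurable A ->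
    (\int[pi]_s comb_trans s A)%E = pi A.

Definition comb_c (n : nat) : R :=
  \prod_(k < n) fine (q (CtxFin k) [set false]).

End comb.

Section dirichlet.
Variable R : realType.

Definition cexp (z : R[i]) : R[i] :=
  (expR (complex.Re z))%:C * (cos (complex.Im z) +i* sin (complex.Im z)).

(* x^s for x >= 0, with 0^s = 0; only used at nonnegative x.  The type R[i]^o
   is R[i] as a normed module over itself, which gives it its topology. *)
Definition cpow (x : R) (s : R[i]) : R[i]^o :=
  if 0 < x then cexp (s * (ln x)%:C) else 0.

Definition wprob (pi : probability leftseq R) (w : seq bool) : R :=
  fine (pi (cyl w)).

Definition Lambda_abs_cvg (pi : probability leftseq R) (s : R[i]) : Prop :=
  summable [set: seq bool] (fun w => (Normc.normc (cpow (wprob pi w) s))%:E).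

(* unordered sum: limit of the sums over finite sets of words *)
Definition Lambda (pi : probability leftseq R) (s : R[i]) : R[i]^o :=
  summability.sum (fun w : seq bool => cpow (wprob pi w) s).

End dirichlet.

(* Main.v *)
Require Import Defs.
From HB Require Import structures.
From mathcomp Require Import all_boot all_order all_algebra.
From mathcomp Require Import complex.
From mathcomp Require Import finmap.
From mathcomp Require Import all_classical all_reals all_analysis.
From mathcomp Require Import measurable_realfun ring lra.
From mathcomp Require summability.
Import Order.TTheory GRing.Theory Num.Theory.
Import numFieldNormedType.Exports.
Local Open Scope classical_set_scope.
Local Open Scope ring_scope.

(** Every word is either 0^n or u 1 0^n, for a unique n and a unique word u.
    Write p(w) for the measure of the sequences ending with w.  Since
    u 1 0^n determines the context of the chain, stationarity gives

      p(u 1 0^n) = p(u1) c_n   and   p(u 1 0^n 1) = p(u1) (c_n - c_{n+1}).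

    On the other side, prefixing a letter to 0^n gives
    p(0^n) = p(0^{n+1}) + p(1) c_n; absolute convergence at s forces
    p(0^n) -> 0, hence p(0^n) = p(1) R_n, and n = 0 yields p(1) S(1) = 1.
    Comparing the two ways of splitting p(0^n), by the letter before and by
    the letter after, gives p(0^n 1) = p(1 0^n) = p(1) c_n.

    Let phi be x |-> x^s, or more generally any function that is
    multiplicative on the nonnegative reals, and let G be the sum of
    phi(p(u1)) over all words u.  Splitting the words of Lambda and of G into
    the two types above gives (comb_equations)

      Lambda = phi(p(1)) sum_n phi(R_n) + G sum_n phi(c_n),
      G = phi(p(1)) sum_n phi(c_n) + G sum_n phi(c_n - c_{n+1}).

    Solving the second equation for G and substituting proves the formula,
    provided that the coefficient of G is not 1.  For this, take for phi the
    modulus of x^s: all terms become nonnegative, the finite positive number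
    phi(p(1)) sum_n phi(c_n) equals G (1 - sum_n phi(c_n - c_{n+1})), so the
    sum of the moduli of (c_n - c_{n+1})^s is less than 1.

    The splitting of a sum over words into a product of sums does not need a
    Fubini theorem: the finite sets made of the 0^n and the u 1 0^n with u in
    a finite set A and n < N are cofinal among the finite sets of words
    (cvg_block), and on each of them the sum factors exactly
    (partial_sum_block). *)

Set Implicit Arguments.
Unset Strict Implicit.
Unset Printing Implicit Defensive.

#[local] Existing Instance summability.totally_filter.
Local Notation totally := summability.totally.
Local Notation partial_sum := summability.partial_sum.

(** * Unordered sums of absolutely summable families *)

Lemma partial_sumE (I : choiceType) (V : zmodType) (f : I -> V) (A : {fset I}) :
  partial_sum f A = \sum_(i <- A) f i.
Proof. by rewrite /summability.partial_sum (big_seq_fsetE _ A xpredT f). Qed.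

(** For nonnegative terms the finite sums are monotone along inclusion, and
    their supremum is the extended sum. *)
Lemma summable_ge0_cvg (R : realType) (I : choiceType) (f : I -> R) :
  (forall i, 0 <= f i) -> summable [set: I] (EFin \o f) ->
  cvg (partial_sum f @ totally).
Proof.
move=> f0 fs.
have sE : (\esum_(i in [set: I]) `|(EFin \o f) i|%E =
    \esum_(i in [set: I]) (f i)%:E)%E.
  by apply: eq_esum => i _ /=; rewrite ger0_norm.
have fin : (\esum_(i in [set: I]) (f i)%:E)%E \is a fin_num.
  by rewrite -sE -summableE.
apply/cvg_ex; exists (fine (\esum_(i in [set: I]) (f i)%:E)%E).
apply/cvgrPdist_lt => e e0.
set l := fine _.
have lE : l%:E = (\esum_(i in [set: I]) (f i)%:E)%E by rewrite fineK.
have : ((l - e)%:E < \esum_(i in [set: I]) (f i)%:E)%E.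
  by rewrite -lE lte_fin ltrBlDr ltrDl.
rewrite /esum => /ereal_sup_gt [_ [X [finX _] <-]].
have sumE (A : {fset I}) :
    (\sum_(i \in [set` A]) (f i)%:E = (partial_sum f A)%:E)%E.
  by rewrite fsbig_finite//= set_fsetK partial_sumE sumEFin.
move=> eX; exists (fset_set X) => //= B XB.
have XB' : X `<=` [set` B].
  by move=> i Xi; apply: (fsubsetP XB); rewrite in_fset_set// inE.
have le1 : (\sum_(i \in X) (f i)%:E <= (partial_sum f B)%:E)%E.
  rewrite -sumE; apply: lee_fsum_nneg_subset => //.
    by move=> i; rewrite !inE => /XB'.
  by move=> i _; rewrite lee_fin.
have le2 : ((partial_sum f B)%:E <= l%:E)%E.
  by rewrite lE -sumE; apply: esum_ge; exists [set` B] => //; split.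
have {}eX := lt_le_trans eX le1.
rewrite lee_fin in le2; rewrite lte_fin in eX.
by rewrite ger0_norm ?subr_ge0// ltrBlDr -ltrBlDl.
Qed.

Lemma summable_le (R : realType) (I : choiceType) (f g : I -> R) :
  (forall i, `|f i| <= `|g i|) -> summable [set: I] (EFin \o g) ->
  summable [set: I] (EFin \o f).
Proof.
by move=> fg; apply: le_lt_trans; apply: le_esum => i _ /=; rewrite lee_fin.
Qed.

Lemma summable_comp (R : realType) (I J : choiceType) (e : I -> J)
    (f : J -> R) :
  injective e -> summable [set: J] (EFin \o f) ->
  summable [set: I] (EFin \o (f \o e)).
Proof.
move=> einj; apply: le_lt_trans.
rewrite -(@esum_image _ _ _ [set: I] e (fun j => `|(f j)%:E|)%E); last first.
  by move=> i j _ _ /einj.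
rewrite esum_mkcond; apply: le_esum => j _.
by case: ifP => // _; rewrite lee_fin.
Qed.

Lemma normc_ge0 (R : rcfType) (z : R[i]) : 0 <= Normc.normc z.
Proof. by case: z => x y; exact: sqrtr_ge0. Qed.

Lemma normc_real (R : rcfType) (x : R) : `|x%:C%C| = `|x|%:C%C.
Proof. by rewrite normc_def/= expr0n/= addr0 sqrtr_sqr. Qed.

Lemma complex_cvg (R : realType) (T : Type) (F : set_system T)
    {FF : Filter F} (f : T -> R[i]^o) (a b : R) :
  complex.Re (f t) @[t --> F] --> a -> complex.Im (f t) @[t --> F] --> b ->
  f @ F --> (Complex a b : R[i]^o).
Proof.
move=> fa fb; apply/cvgrPdist_lt => -[e e'].
rewrite ltcE/= => /andP[/eqP -> e0].
have e20 : 0 < e / 2 by rewrite divr_gt0.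
near=> t.
have h1 : `|a - complex.Re (f t)| < e / 2.
  by near: t; move/cvgrPdist_lt : fa => /(_ _ e20).
have h2 : `|b - complex.Im (f t)| < e / 2.
  by near: t; move/cvgrPdist_lt : fb => /(_ _ e20).
case: (f t) h1 h2 => x y /= h1 h2.
have -> : (Complex a b - Complex x y : R[i]^o) =
    (a - x)%:C%C + 'i%C * (b - y)%:C%C.
  by apply/eqP; rewrite eq_complex/=; apply/andP; split; apply/eqP; ring.
apply: (@le_lt_trans _ _ ((`|a - x| + `|b - y|)%:C%C : R[i])).
  apply: le_trans (ler_normD _ _) _.
  by rewrite normrM normCi mul1r !normc_real rmorphD.
by rewrite ltcE/= eqxx/= [e]splitr ltrD.
Unshelve. all: by end_near. Qed.

Lemma partial_sum_Re (R : rcfType) (I : choiceType) (f : I -> R[i]) A :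
  complex.Re (partial_sum f A) = partial_sum (fun i => complex.Re (f i)) A.
Proof. by rewrite !partial_sumE raddf_sum. Qed.

Lemma partial_sum_Im (R : rcfType) (I : choiceType) (f : I -> R[i]) A :
  complex.Im (partial_sum f A) = partial_sum (fun i => complex.Im (f i)) A.
Proof. by rewrite !partial_sumE raddf_sum. Qed.

(** Write f as the difference of the nonnegative families f + |f| and |f|. *)
Lemma summable_totally_cvg (R : realType) (I : choiceType) (f : I -> R) :
  summable [set: I] (EFin \o f) -> cvg (partial_sum f @ totally).
Proof.
move=> fs.
have fas : summable [set: I] (EFin \o (fun i => `|f i|)).
  by apply: summable_le fs => i; rewrite normr_id.
have fE : partial_sum f =
    partial_sum (fun i => f i + `|f i|) - partial_sum (fun i => `|f i|).
  apply/funext => A; rewrite opprfctE addrfctE !partial_sumE -sumrB.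
  by apply: eq_bigr => i _; rewrite addrK.
rewrite fE; apply: is_cvgB; apply: summable_ge0_cvg => //.
- by move=> i; have := ler_norm (- f i); rewrite normrN; lra.
- exact: summableD fs fas.
Qed.

(** The modulus bounds the real and the imaginary parts. *)
Lemma summable_normc_cvg (R : realType) (I : choiceType) (f : I -> R[i]^o) :
  summable [set: I] (fun i => (Normc.normc (f i))%:E) ->
  cvg (partial_sum f @ totally).
Proof.
move=> fs.
have /cvg_ex[a ha] : cvg (partial_sum (fun i => complex.Re (f i)) @ totally).
  apply: summable_totally_cvg; apply: summable_le fs => i.
  rewrite [X in _ <= X]ger0_norm//; last exact: normc_ge0.
  by have := normc_ge_Re (f i); rewrite lecR.
have /cvg_ex[b hb] : cvg (partial_sum (fun i => complex.Im (f i)) @ totally).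
  apply: summable_totally_cvg; apply: summable_le fs => i.
  rewrite [X in _ <= X]ger0_norm//; last exact: normc_ge0.
  by case: (f i) => x y /=; rewrite -sqrtr_sqr ler_wsqrtr// lerDr sqr_ge0.
apply/cvg_ex; exists (Complex a b); apply: complex_cvg.
- by under eq_cvg do rewrite partial_sum_Re.
- by under eq_cvg do rewrite partial_sum_Im.
Qed.

Lemma partial_sum_series (V : zmodType) (f : nat -> V) N :
  partial_sum f [fset i | i in iota 0 N]%fset = series f N.
Proof.
rewrite partial_sumE /series/= /index_iota subn0; apply: perm_big.
apply: uniq_perm; rewrite ?fset_uniq ?iota_uniq// => i.
by apply/imfsetP/idP => /= [[j jN ->]//|iN]; exists i.
Qed.

(** The initial segments are cofinal among the finite sets of natural
    numbers, so an unordered sum over them is also the sum of the series. *)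
Lemma cvg_totally_iota :
  [fset i | i in iota 0 N]%fset @[N --> \oo] --> (@totally nat).
Proof.
move=> P [A _ AP]; exists (\max_(i <- A) i).+1 => //= N /= AN.
apply: AP => /=; apply/fsubsetP => i iA; apply/imfsetP; exists i => //=.
rewrite mem_iota/= add0n; apply: leq_trans AN; rewrite ltnS.
by rewrite (big_rem i)//= leq_maxl.
Qed.

Lemma cvg_partial_sum_series (V : zmodType) (f : nat -> V) (G : set_system V) :
  partial_sum f @ totally --> G -> series f @ \oo --> G.
Proof.
move=> fG; rewrite (_ : series f = partial_sum f \o
    (fun N => [fset i | i in iota 0 N]%fset)).
  by apply: cvg_comp fG; exact: cvg_totally_iota.
by apply/funext => N /=; rewrite partial_sum_series.
Qed.

(** * Splitting words at their last letter 1 *)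

Definition zeros n : seq bool := nseq n false.
Definition one_zeros n : seq bool := true :: zeros n.

Lemma zeros_inj : injective zeros.
Proof. by move=> m n /(congr1 size); rewrite !size_nseq. Qed.

Lemma one_notin_zeros n : true \notin zeros n.
Proof. by rewrite mem_nseq andbF. Qed.

(** The number of trailing zeros is read off the reversed word. *)
Lemma cat_one_zeros_inj u v m n :
  u ++ one_zeros m = v ++ one_zeros n -> (u, m) = (v, n).
Proof.
move=> uv.
have revE w k : rev (w ++ one_zeros k) = zeros k ++ true :: rev w.
  by rewrite rev_cat /one_zeros rev_cons rev_nseq cat_rcons.
have findE w k : find id (rev (w ++ one_zeros k)) = k.
  rewrite revE find_cat size_nseq/= addn0.
  by rewrite (_ : has _ _ = false)// has_nseq andbF.
have mn : m = n by rewrite -(findE u m) uv findE.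
rewrite mn in uv *; have /(congr1 size) := uv.
rewrite !size_cat => /addIn suv.
by move/eqP: uv; rewrite eqseq_cat// => /andP[/eqP-> _].
Qed.

(** The bounds on the sizes say which block contains a given finite set. *)
Lemma word_split w :
  w = zeros (size w) \/
  exists u n, [/\ w = u ++ one_zeros n, (size u < size w)%N & (n < size w)%N].
Proof.
elim/last_ind: w => [|w [] IH]; first by left.
  by right; exists w, 0%N; rewrite /one_zeros/= cats1 size_rcons.
case: IH => [wE|[u [n [wE su sn]]]].
  by left; rewrite {1}wE size_rcons /zeros -addn1 nseqD cats1.
right; exists u, n.+1; rewrite !size_rcons; split; [|exact: ltnW|by []].
by rewrite {1}wE rcons_cat /one_zeros /zeros -addn1 nseqD cats1.
Qed.

(** A cofinal family of finite sets of words, on which sums factor. *)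
Definition block (p : {fset seq bool} * nat) : {fset seq bool} :=
  [fset w | w in [seq zeros n | n <- iota 0 p.2] ++
                 [seq u ++ one_zeros n | u <- p.1, n <- iota 0 p.2]]%fset.

Lemma cvg_block :
  block p @[p --> (@totally (seq bool), \oo)] --> (@totally (seq bool)).
Proof.
move=> P [B _ BP].
have [M ltM] : exists M, forall w, w \in B -> (size w < M)%N.
  exists (\max_(w <- B) size w).+1 => w wB.
  by rewrite ltnS (big_rem w)//= leq_maxl.
exists ([set A | [fset take k w | w in B, k in iota 0 M]%fset `<=` A]%fset,
  [set N | (M <= N)%N]).
  split => /=; last by exists M.
  by exists [fset take k w | w in B, k in iota 0 M]%fset.
move=> [A N] /= [/fsubsetP BA MN]; apply: BP => /=; apply/fsubsetP => w wB.
apply/imfsetP; exists w => //=; rewrite mem_cat.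
have [wE|[u [n [wE su sn]]]] := word_split w.
  apply/orP; left; rewrite wE map_f// mem_iota/=.
  exact: leq_trans (ltM _ wB) MN.
apply/orP; right; apply/allpairsP; exists (u, n) => /=; split=> //.
  apply: BA; apply/imfset2P; exists w => //; exists (size u).
    by rewrite /= mem_iota (ltn_trans su)// ltM.
  by rewrite wE take_size_cat.
by rewrite mem_iota/= (leq_trans sn)// (leq_trans _ MN)// ltnW// ltM.
Qed.

Lemma partial_sum_block (K : pzRingType) (f g : seq bool -> K) (a b : nat -> K)
    (p : {fset seq bool} * nat) :
  (forall n, f (zeros n) = a n) ->
  (forall u n, f (u ++ one_zeros n) = g u * b n) ->
  partial_sum f (block p) =
  series a p.2 + partial_sum g p.1 * series b p.2.
Proof.
move=> fa fgb; case: p => A N /=; rewrite !partial_sumE.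
pose s := [seq zeros n | n <- iota 0 N] ++
  [seq u ++ one_zeros n | u <- A, n <- iota 0 N].
have us : uniq s.
  rewrite cat_uniq map_inj_uniq ?iota_uniq; last exact: zeros_inj.
  rewrite allpairs_uniq ?fset_uniq ?iota_uniq//; last first.
    by move=> [u m] [v n] _ _ /=; exact: cat_one_zeros_inj.
  rewrite andbT; apply/hasPn => _ /allpairsP[[u n] [_ _ ->]]/=.
  apply/negP => /mapP[m _] e; have := one_notin_zeros m.
  by rewrite -e mem_cat inE eqxx orbT.
rewrite (perm_big s)/=; last first.
  apply: uniq_perm; rewrite ?fset_uniq// => w.
  by apply/imfsetP/idP => /= [[v vs ->]//|ws]; exists w.
rewrite big_cat/= big_map big_allpairs_dep/= /series/= /index_iota subn0.
congr (_ + _); first exact: eq_bigr.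
by rewrite big_distrlr/=; apply: eq_bigr => u _; apply: eq_bigr.
Qed.

(** Both sides are limits, along the blocks, of the same finite sums.  The
    field is arbitrary because the lemma serves for the complex sums and for
    the sums of their moduli. *)
Lemma unordered_sum_split (K : numFieldType) (f g : seq bool -> K)
    (a b : nat -> K) (lf lg la lb : K) :
  (forall n, f (zeros n) = a n) ->
  (forall u n, f (u ++ one_zeros n) = g u * b n) ->
  partial_sum f @ totally --> lf -> partial_sum g @ totally --> lg ->
  series a @ \oo --> la -> series b @ \oo --> lb ->
  lf = la + lg * lb.
Proof.
move=> fa fgb fl gl al bl.
have h1 := cvg_comp _ _ cvg_block fl.
have h2 : partial_sum f (block p) @[p --> (@totally (seq bool), \oo)] -->
    la + lg * lb.
  under eq_cvg do rewrite (partial_sum_block _ fa fgb).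
  apply: cvgD; first exact: cvg_comp cvg_snd al.
  by apply: cvgM; [exact: cvg_comp cvg_fst gl|exact: cvg_comp cvg_snd bl].
exact: (cvg_unique (@norm_hausdorff _ K^o) h1 h2).
Qed.

(** * Complex powers of nonnegative reals *)

Lemma cexpD (R : realType) (z w : R[i]) : cexp (z + w) = cexp z * cexp w.
Proof.
case: z w => [a b] [c d]; rewrite /cexp/= expRD cosD sinD.
by apply/eqP; rewrite eq_complex/=; apply/andP; split; apply/eqP; ring.
Qed.

Lemma normc_cexp (R : realType) (z : R[i]) :
  Normc.normc (cexp z) = expR (complex.Re z).
Proof.
rewrite /cexp Normc.normcM/= cos2Dsin2 sqrtr1 mulr1 expr0n/= addr0 sqrtr_sqr.
by rewrite ger0_norm// expR_ge0.
Qed.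

Lemma cpow0 (R : realType) (s : R[i]) : cpow 0 s = 0.
Proof. by rewrite /cpow ltxx. Qed.

Lemma cpow1 (R : realType) (s : R[i]) : cpow 1 s = 1.
Proof.
rewrite /cpow ltr01 ln1 mulr0 /cexp/= expR0 cos0 sin0.
by apply/eqP; rewrite eq_complex/=; apply/andP; split; apply/eqP; ring.
Qed.

Lemma cpowM (R : realType) (s : R[i]) (x y : R) : 0 <= x -> 0 <= y ->
  cpow (x * y) s = cpow x s * cpow y s.
Proof.
rewrite !le_eqVlt => /predU1P[<-|x0] /predU1P[<-|y0];
  rewrite ?(mul0r, mulr0, cpow0)//.
by rewrite /cpow x0 y0 mulr_gt0// lnM// rmorphD/= mulrDr cexpD.
Qed.

Lemma normc_cpow (R : realType) (s : R[i]) (x : R) : 0 < x ->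
  Normc.normc (cpow x s) = expR (complex.Re s * ln x).
Proof.
move=> x0; rewrite /cpow x0 normc_cexp; congr expR.
by case: s => a b /=; ring.
Qed.

Lemma normc_cpow_le (R : realType) (s : R[i]) (x y : R) :
  0 < complex.Re s -> x <= y ->
  Normc.normc (cpow x s) <= Normc.normc (cpow y s).
Proof.
move=> s0 xy; have [x0|x0] := ltP 0 x; last first.
  rewrite [in leLHS]/cpow ltNge x0/= [leLHS](Normc.normc0 R).
  exact: normc_ge0.
have y0 := lt_le_trans x0 xy.
by rewrite !normc_cpow// ler_expR ler_pM2l// ler_ln.
Qed.

Lemma cpow_eq0 (R : realType) (s : R[i]) (x : R) : 0 < x -> cpow x s != 0.
Proof.
move=> x0; apply/eqP => /(congr1 (@Normc.normc R)).
rewrite normc_cpow// [RHS](Normc.normc0 R) => /eqP.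
by rewrite gt_eqF ?expR_gt0.
Qed.

(** * The stationary measure of cylinders *)

Section comb.
Variables (R : realType) (q : comb_context -> probability bool R).
Variable pi : probability leftseq R.
Hypothesis pi_stat : stationary q pi.
Local Notation p := (wprob pi).
Local Notation c := (comb_c q).

Let q0 n : R := fine (q (CtxFin n) [set false]).

Lemma pi_cyl w : pi (cyl w) = (p w)%:E.
Proof. by rewrite /wprob fineK// fin_num_measure//; exact: measurable_cyl. Qed.

Lemma wprob_ge0 w : 0 <= p w.
Proof. by rewrite -lee_fin -pi_cyl. Qed.

Lemma wprob_nil : p [::] = 1.
Proof.
rewrite /wprob (_ : cyl [::] = setT) ?probability_setT//.
by apply/seteqP.
Qed.

Lemma cyl_rcons w a s : cyl (rcons w a) s <-> s 0%N = a /\ cyl w (s \o S).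
Proof.
rewrite /cyl/= size_rcons /mkseq/= rev_cons.
rewrite -[1%N]addn0 iotaDl -map_comp.
by split => [/rcons_inj[-> ->]//|[-> ->]].
Qed.

Lemma cyl_cons w a s : cyl (a :: w) s <-> s (size w) = a /\ cyl w s.
Proof.
rewrite /cyl/= /mkseq -(addn1 (size w)) iotaD map_cat/= rev_cat/= add0n.
by split => [[-> ->]//|[-> ->]].
Qed.

Lemma cyl_cat u v s : cyl (u ++ v) s -> cyl v s.
Proof. by elim: u => // a u IH; rewrite cat_cons => /cyl_cons[_]. Qed.

(** Once a word contains the letter 1, its run of trailing zeros determines
    the context of every sequence that it ends. *)
Lemma pref_one_zeros u n s : cyl (u ++ one_zeros n) s -> pref s = CtxFin n.
Proof.
move=> /cyl_cat us; apply/prefP => /=.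
move: us; rewrite /cyl/= size_nseq => /(congr1 rev).
by rewrite revK rev_cons rev_nseq.
Qed.

(** The cylinder of w splits according to the letter that precedes w. *)
Lemma wprob_cons w : p w = p (false :: w) + p (true :: w).
Proof.
apply: EFin_inj; rewrite EFinD -!pi_cyl.
rewrite (_ : cyl w = cyl (false :: w) `|` cyl (true :: w)).
  apply: measureU; [exact: measurable_cyl|exact: measurable_cyl|].
  by apply/seteqP; split => // s [/cyl_cons[e _] /cyl_cons[]]; rewrite e.
apply/seteqP; split => s.
  by move=> ws; case E : (s (size w)); [right|left]; apply/cyl_cons.
by case=> /cyl_cons[].
Qed.

Lemma comb_trans_rcons w a s : comb_trans q s (cyl (rcons w a)) =
  ((\1_(cyl w) s)%:E * q (pref s) [set a])%E.
Proof.
rewrite /comb_trans/= /distribution /pushforward/= indicE.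
have [ws|ws] := boolP (s \in cyl w).
  rewrite mul1e; congr (q _ _); apply/seteqP; split => b /=.
    by move=> /cyl_rcons[].
  by move=> ->; apply/cyl_rcons; split => //; exact: set_mem ws.
rewrite mul0e (_ : _ @^-1` _ = set0) ?measure0//.
apply/seteqP; split => // b /= /cyl_rcons[_ h].
by case/negP: ws; exact: mem_set h.
Qed.

(** On the cylinder of w the next letter is drawn from the law of a single
    context, so the integrand of stationarity is constant there. *)
Lemma wprob_rcons_const w a n : (forall s, cyl w s -> pref s = CtxFin n) ->
  p (rcons w a) = p w * fine (q (CtxFin n) [set a]).
Proof.
move=> wn; apply: EFin_inj.
rewrite -pi_cyl -pi_stat; last exact: measurable_cyl.
have fq : q (CtxFin n) [set a] \is a fin_num by exact: fin_num_measure.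
under eq_integral => s _.
  rewrite comb_trans_rcons (_ : (_ * _)%E =
    (fine (q (CtxFin n) [set a]))%:E * (\1_(cyl w) s)%:E)%E; last first.
    rewrite fineK// muleC indicE; have [ws|] := boolP (s \in cyl w).
      by rewrite wn//; exact: set_mem ws.
    by rewrite !mule0.
  over.
rewrite ge0_integralZl//=; last 2 first.
- by apply/measurable_EFinP; exact: measurable_indic (measurable_cyl w).
- by rewrite lee_fin fine_ge0.
rewrite integral_indic ?setIT//; last exact: measurable_cyl.
by rewrite EFinM -pi_cyl muleC.
Qed.

(** The chain moves into one of the two cylinders exactly when it starts in
    the cylinder of w, whatever the context of its starting point. *)
Lemma wprob_rcons w : p w = p (rcons w false) + p (rcons w true).
Proof.
apply: EFin_inj; rewrite EFinD -!pi_cyl.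
rewrite -measureU; [|exact: measurable_cyl..|]; last first.
  by apply/seteqP; split => // s [/cyl_rcons[e _] /cyl_rcons[]]; rewrite e.
rewrite -[RHS]pi_stat; last by apply: measurableU; exact: measurable_cyl.
rewrite (_ : pi (cyl w) = \int[pi]_s (\1_(cyl w) s)%:E)%E; last first.
  by rewrite integral_indic ?setIT//; exact: measurable_cyl.
apply: eq_integral => s _.
rewrite /comb_trans/= /distribution /pushforward/= indicE.
have [ws|ws] := boolP (s \in cyl w).
  rewrite (_ : _ @^-1` _ = setT) ?probability_setT//.
  apply/seteqP; split => // -[] _; [right|left]; apply/cyl_rcons; split=> //;
    exact: set_mem ws.
rewrite (_ : _ @^-1` _ = set0) ?measure0//.
apply/seteqP; split => // b [] /cyl_rcons[_ h];
  by case/negP: ws; exact: mem_set h.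
Qed.

Lemma comb_cS n : c n.+1 = c n * q0 n.
Proof. by rewrite /comb_c big_ord_recr. Qed.

Lemma comb_q1 n : fine (q (CtxFin n) [set true]) = 1 - q0 n.
Proof.
have : (q (CtxFin n) [set false] + q (CtxFin n) [set true] = 1)%E.
  rewrite -measureU//; last by apply/seteqP; split => // b [/= ->].
  rewrite (_ : _ `|` _ = setT); first exact: probability_setT.
  by apply/seteqP; split => -[] // _; [right|left].
move=> /(congr1 fine); rewrite fineD ?fin_num_measure//= => <-.
by rewrite addrC addKr.
Qed.

Lemma comb_c_ge0 n : 0 <= c n.
Proof. by apply: prodr_ge0 => k _; exact: fine_ge0. Qed.

Lemma comb_q0_le1 n : q0 n <= 1.
Proof. by rewrite -subr_ge0 -comb_q1 fine_ge0. Qed.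

Lemma comb_c_le n : c n.+1 <= c n.
Proof. by rewrite comb_cS ler_piMr ?comb_c_ge0 ?comb_q0_le1. Qed.

Lemma wprob_one_zeros u n :
  p (u ++ one_zeros n) = p (rcons u true) * c n.
Proof.
elim: n => [|n IH]; first by rewrite /one_zeros/= cats1 /comb_c big_ord0 mulr1.
rewrite comb_cS mulrA -IH -(wprob_rcons_const _ (@pref_one_zeros u n)).
by congr p; rewrite rcons_cat /one_zeros /zeros -addn1 nseqD cats1.
Qed.

Lemma wprob_one_zeros_one u n :
  p (rcons (u ++ one_zeros n) true) = p (rcons u true) * (c n - c n.+1).
Proof.
rewrite (wprob_rcons_const _ (@pref_one_zeros u n)) wprob_one_zeros comb_q1.
by rewrite comb_cS; ring.
Qed.

(** Appending or prefixing a zero to 0^n gives the same word, so 0^n 1 and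
    1 0^n both have measure p(0^n) - p(0^{n+1}). *)
Lemma wprob_zeros_one n : p (rcons (zeros n) true) = p [:: true] * c n.
Proof.
rewrite -(wprob_one_zeros [::])/= /one_zeros.
have zE : rcons (zeros n) false = false :: zeros n.
  by rewrite -cats1 /zeros -[[:: false]]/(nseq 1 false) -nseqD addn1.
have := wprob_cons (zeros n); rewrite (wprob_rcons (zeros n)) zE.
by move/addrI.
Qed.

Lemma wprob_zerosS n : p (zeros n) = p (zeros n.+1) + p [:: true] * c n.
Proof. by rewrite wprob_cons -(wprob_one_zeros [::]). Qed.

Lemma wprob_zeros_sum n N : (n <= N)%N ->
  p (zeros n) = p (zeros N) + p [:: true] * \sum_(n <= k < N) c k.
Proof.
elim: N => [|N IH].
  by rewrite leqn0 => /eqP ->; rewrite big_geq// mulr0 addr0.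
rewrite leq_eqVlt => /predU1P[->|]; first by rewrite big_geq// mulr0 addr0.
rewrite ltnS => nN; rewrite IH// wprob_zerosS big_nat_recr//=; ring.
Qed.

(** The limit of wprob_zeros_sum: since p(0^N) tends to 0, all the mass of the
    cylinder of 0^n lies on the sequences that contain a 1. *)
Lemma wprob_zeros n : cvgn (series c) -> p (zeros k) @[k --> \oo] --> 0 ->
  p (zeros n) = p [:: true] * limn (fun N => \sum_(n <= k < N) c k).
Proof.
move=> cc z0; have ccn : cvgn (fun N => \sum_(n <= k < N) c k).
  rewrite (_ : (fun _ => _) = [sequence \sum_(n <= k < N) c k]_N)//.
  by rewrite is_cvg_series_restrict.
apply: (cvg_unique (@norm_hausdorff _ R^o) (F := p (zeros n) @[_ --> \oo])).
  exact: cvg_cst.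
have h : p (zeros N) + p [:: true] * \sum_(n <= k < N) c k @[N --> \oo] -->
    0 + p [:: true] * limn (fun N => \sum_(n <= k < N) c k).
  by apply: cvgD => //; apply: cvgM => //; exact: cvg_cst.
rewrite add0r in h; apply: cvg_trans h; apply: near_eq_cvg.
by near=> N; rewrite -wprob_zeros_sum//; near: N; exact: nbhs_infty_ge.
Unshelve. all: by end_near. Qed.

End comb.

(** * The Dirichlet series *)

Lemma cvg_series_scale (K : numFieldType) (k : K) (f : nat -> K) (l : K) :
  series f @ \oo --> l -> series (fun n => k * f n) @ \oo --> k * l.
Proof.
move=> fl; rewrite (_ : series _ = (fun n => k * series f n)).
  by apply: cvgM => //; exact: cvg_cst.
by apply/funext => n; rewrite /series/= mulr_sumr.
Qed.

Section dirichlet.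
Variables (R : realType) (q : comb_context -> probability bool R).
Variable pi : probability leftseq R.
Hypothesis pi_stat : stationary q pi.
Hypothesis c_cvg : cvgn (series (comb_c q)).
Local Notation p := (wprob pi).
Local Notation c := (comb_c q).
Local Notation p1 := (p [:: true]).
Local Notation Rn := (fun n : nat => limn (fun N => \sum_(n <= k < N) c k)).
Local Notation S1 := (limn (series c)).

(** A summable family over the words 0^n tends to 0, and x |-> |x^s| is
    increasing because Re s > 0.  So absolute convergence excludes an atom of
    pi at the sequence 000..., which is possible when that context always
    emits 0. *)
Lemma wprob_zeros_cvg0 (s : R[i]) : 0 < complex.Re s -> Lambda_abs_cvg pi s ->
  p (zeros n) @[n --> \oo] --> 0.
Proof.
move=> s0 ps; apply/cvgrPdist_lt => e e0.
have /summable_totally_cvg/cvg_ex[l hl] := summable_comp zeros_inj ps.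
have /cvg_series_cvg_0/cvgrPdist_lt h := cvgP _ (cvg_partial_sum_series hl).
have ce0 : 0 < Normc.normc (cpow e s) by rewrite normc_cpow// expR_gt0.
near=> n; rewrite sub0r normrN ger0_norm ?wprob_ge0// ltNge; apply/negP => en.
have : `|0 - Normc.normc (cpow (p (zeros n)) s)| < Normc.normc (cpow e s).
  by near: n; exact: h.
by rewrite sub0r normrN ger0_norm ?normc_ge0// ltNge normc_cpow_le.
Unshelve. all: by end_near. Qed.

Hypothesis zeros_cvg0 : p (zeros n) @[n --> \oo] --> 0.

Lemma wprob_one_S1 : S1 * p1 = 1.
Proof.
have := wprob_zeros pi_stat 0 c_cvg zeros_cvg0.
by rewrite wprob_nil mulrC => <-.
Qed.

Lemma wprob_one_gt0 : 0 < p1.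
Proof.
rewrite lt_neqAle wprob_ge0 andbT eq_sym; apply/eqP => p10.
by move/eqP: wprob_one_S1; rewrite p10 mulr0 eq_sym oner_eq0.
Qed.

Lemma S1_ge0 : 0 <= S1.
Proof.
by apply: limr_ge => //; near=> n; apply: sumr_ge0 => k _; exact: comb_c_ge0.
Unshelve. all: by end_near. Qed.

Lemma comb_equations (K : numFieldType) (phi : R -> K) (lL lG lR lC lD : K) :
  (forall x y, 0 <= x -> 0 <= y -> phi (x * y) = phi x * phi y) ->
  partial_sum (fun w => phi (p w)) @ totally --> lL ->
  partial_sum (fun u => phi (p (rcons u true))) @ totally --> lG ->
  series (fun n => phi (Rn n)) @ \oo --> lR ->
  series (fun n => phi (c n)) @ \oo --> lC ->
  series (fun n => phi (c n - c n.+1)) @ \oo --> lD ->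
  lL = phi p1 * lR + lG * lC /\ lG = phi p1 * lC + lG * lD.
Proof.
move=> phiM hL hG hR hC hD; split.
- apply: (unordered_sum_split (f := fun w => phi (p w))
    (g := fun u => phi (p (rcons u true)))
    (a := fun n => phi p1 * phi (Rn n)) (b := fun n => phi (c n))) => //;
    last exact: cvg_series_scale hR.
    move=> n; rewrite (wprob_zeros pi_stat n c_cvg zeros_cvg0).
    rewrite phiM ?wprob_ge0//.
    have := wprob_ge0 pi (zeros n).
    rewrite (wprob_zeros pi_stat n c_cvg zeros_cvg0) pmulr_rge0//.
    exact: wprob_one_gt0.
  by move=> u n; rewrite (wprob_one_zeros pi_stat) phiM ?wprob_ge0 ?comb_c_ge0.
- apply: (unordered_sum_split (f := fun u => phi (p (rcons u true)))
    (g := fun u => phi (p (rcons u true)))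
    (a := fun n => phi p1 * phi (c n))
    (b := fun n => phi (c n - c n.+1))) => //;
    last exact: cvg_series_scale hC.
    by move=> n; rewrite (wprob_zeros_one pi_stat) phiM ?wprob_ge0 ?comb_c_ge0.
  move=> u n; rewrite (wprob_one_zeros_one pi_stat) phiM ?wprob_ge0//.
  by rewrite subr_ge0 comb_c_le.
Qed.

(** R_n, c_n and c_n - c_{n+1} are, up to the factor S1, the measures of the
    words 0^n, 1 0^n and 1 0^n 1, so each of the three series is, up to the
    factor S1^s, a subsum of Lambda. *)
Lemma subfamily_series_cvg (s : R[i]) (e : nat -> seq bool) (x : nat -> R) :
  Lambda_abs_cvg pi s -> injective e -> (forall n, x n = S1 * p (e n)) ->
  cvgn (series (fun n => cpow (x n) s)) /\
  cvgn (series (fun n => Normc.normc (cpow (x n) s))).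
Proof.
move=> ps einj xE.
have pe := summable_comp einj ps.
have cpE n : cpow (x n) s = cpow S1 s * cpow (p (e n)) s.
  by rewrite xE cpowM ?wprob_ge0 ?S1_ge0.
split.
  have /cvg_ex[l hl] := summable_normc_cvg (f := fun n => cpow (p (e n)) s) pe.
  apply/cvg_ex; exists (cpow S1 s * l).
  rewrite (_ : (fun n => _) = fun n => cpow S1 s * cpow (p (e n)) s).
    exact/cvg_series_scale/cvg_partial_sum_series.
  exact/funext.
have /cvg_ex[l hl] := summable_totally_cvg pe.
apply/cvg_ex; exists (Normc.normc (cpow S1 s) * l).
rewrite (_ : (fun n => _) = fun n =>
    Normc.normc (cpow S1 s) * Normc.normc (cpow (p (e n)) s)).
  exact/cvg_series_scale/cvg_partial_sum_series.
by apply/funext => n; rewrite cpE Normc.normcM.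
Qed.

End dirichlet.

Lemma norm_sum_cvg_neq1 (R : realType) (f : nat -> R[i]^o) (l : R[i]^o)
    (m : R) :
  series f @ \oo --> l -> series (fun n => Normc.normc (f n)) @ \oo --> m ->
  m < 1 -> 1 - l != 0.
Proof.
move=> fl nl m1; apply/eqP => /eqP; rewrite subr_eq0 => /eqP l1.
have e0 : (0 : R[i]) < (1 - m)%:C%C by rewrite ltcE/= eqxx/= subr_gt0.
have /cvgrPdist_lt/(_ _ e0)[N _ /(_ N (leqnn N))/=] := fl.
rewrite -l1 => h.
have nN : (`|series f N| <= m%:C%C :> R[i]).
  apply: le_trans (ler_norm_sum _ _ _) _.
  have -> : \sum_(0 <= i < N) `|f i| =
     (series (fun n => Normc.normc (f n)) N)%:C%C :> R[i].
    by rewrite /series/= rmorph_sum/=; apply: eq_bigr => i _; case: (f i).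
  rewrite lecE/= eqxx/= -(cvg_lim _ nl)//.
  apply: nondecreasing_cvgn_le; last by apply: cvgP nl.
  by apply: nondecreasing_series => n _ _; exact: normc_ge0.
have : (1 : R[i]) < 1.
  apply: (@le_lt_trans _ _ (`|1 - series f N| + `|series f N|)).
    by rewrite -[X in X <= _]normr1 -{1}(subrK (series f N) 1) ler_normD.
  apply: lt_le_trans (ltr_leD h nN) _.
  by rewrite -rmorphD/= subrK.
by rewrite ltxx.
Qed.

Theorem proposition27 (R : realType) (q : comb_context -> probability bool R)
    (pi : probability leftseq R) (s : R[i]) :
  stationary q pi ->
  cvgn (series (comb_c q)) ->
  0 < complex.Re s ->
  Lambda_abs_cvg pi s ->
  let c := comb_c q in
  let S1 := limn (series c) in
  let Rn := fun n : nat => limn (fun N => \sum_(n <= k < N) c k) in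
  let cpowR := fun n : nat => cpow (Rn n) s in
  let cpowc := fun n : nat => cpow (c n) s in
  let cpowd := fun n : nat => cpow (c n - c n.+1) s in
  [/\ cvgn (series cpowR), cvgn (series cpowc), cvgn (series cpowd),
      1 - limn (series cpowd) != 0
    & Lambda pi s =
      1 / cpow S1 s *
        (limn (series cpowR) +
         limn (series cpowc) ^+ 2 / (1 - limn (series cpowd)))].
Proof.
move=> pi_stat c_cvg s0 ps c S1 Rn cpowR cpowc cpowd.
have z0 := wprob_zeros_cvg0 s0 ps.
have S1p1 : S1 * wprob pi [:: true] = 1 := wprob_one_S1 pi_stat c_cvg z0.
have S10 : 0 <= S1 := S1_ge0 c_cvg.
have sub := subfamily_series_cvg c_cvg ps.
have rcons_inj : injective (fun u => rcons u true) by move=> u v /rcons_inj[].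
have oz_inj : injective one_zeros by move=> m n [/zeros_inj].
have [cvR ncvR] : cvgn (series cpowR) /\
    cvgn (series (fun n => Normc.normc (cpowR n))).
  apply: (sub _ Rn zeros_inj) => n.
  by rewrite (wprob_zeros pi_stat n c_cvg z0) mulrA S1p1 mul1r.
have [cvc ncvc] : cvgn (series cpowc) /\
    cvgn (series (fun n => Normc.normc (cpowc n))).
  apply: (sub _ c oz_inj) => n.
  by rewrite (wprob_one_zeros pi_stat [::]) mulrA S1p1 mul1r.
have [cvd ncvd] : cvgn (series cpowd) /\
    cvgn (series (fun n => Normc.normc (cpowd n))).
  apply: (sub (fun n => rcons (one_zeros n) true)
    (fun n => c n - c n.+1)) => [m n /rcons_inj/oz_inj//|n].
  by rewrite (wprob_one_zeros_one pi_stat [::]) mulrA S1p1 mul1r.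
(* lG is the sum over the words ending with 1, nG the sum of the moduli. *)
have pG := summable_comp rcons_inj ps.
have /cvg_ex[lG hG] :=
  summable_normc_cvg (f := fun u => cpow (wprob pi (rcons u true)) s) pG.
have hL := summable_normc_cvg (f := fun w => cpow (wprob pi w) s) ps.
have /cvg_ex[nL nhL] := summable_totally_cvg ps.
have /cvg_ex[nG nhG] := summable_totally_cvg pG.
have normM x y : 0 <= x -> 0 <= y -> Normc.normc (cpow (x * y) s) =
    Normc.normc (cpow x s) * Normc.normc (cpow y s).
  by move=> x0 y0; rewrite cpowM// Normc.normcM.
have [_ nGE] := comb_equations pi_stat c_cvg z0 normM nhL nhG ncvR ncvc ncvd.
have [LE GE] := comb_equations (phi := fun x => cpow x s) pi_stat c_cvg z0
  (@cpowM R s) hL hG cvR cvc cvd.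
have p1_gt0 := wprob_one_gt0 pi_stat c_cvg z0.
(* c_0 = 1 is a term of the series. *)
have nC : 0 < limn (series (fun n => Normc.normc (cpowc n))).
  apply: (@lt_le_trans _ _ (series (fun n => Normc.normc (cpowc n)) 1)).
    rewrite /series/= big_nat1 normc_cpow ?expR_gt0//.
    by rewrite /c /comb_c big_ord0.
  apply: nondecreasing_cvgn_le => //.
  by apply: nondecreasing_series => n _ _; exact: normc_ge0.
have nG0 : 0 <= nG.
  rewrite -(cvg_lim _ nhG)//; apply: limr_ge; first exact: cvgP nhG.
  apply: nearW => A; rewrite partial_sumE; apply: sumr_ge0 => u _.
  exact: normc_ge0.
(* The equation for nG reads nG (1 - D) = |p(1)^s| C, where C > 0. *)
have D1 : limn (series (fun n => Normc.normc (cpowd n))) < 1.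
  rewrite ltNge; apply/negP => D1.
  have : nG * (1 - limn (series (fun n => Normc.normc (cpowd n)))) <= 0.
    by rewrite mulr_ge0_le0// subr_le0.
  rewrite mulrBr mulr1 {1}nGE addrK leNgt mulr_gt0// normc_cpow//.
  exact: expR_gt0.
have D0 := norm_sum_cvg_neq1 cvd ncvd D1.
split => //.
have Spow : 1 / cpow S1 s = cpow (wprob pi [:: true]) s.
  have S1_gt0 : 0 < S1 by rewrite -(pmulr_lgt0 _ p1_gt0) S1p1.
  apply: (mulfI (cpow_eq0 s S1_gt0)).
  by rewrite -cpowM ?wprob_ge0// S1p1 cpow1 mul1r divff// cpow_eq0.
rewrite Spow [LHS]LE.
have -> : lG = cpow (wprob pi [:: true]) s * limn (series cpowc) /
    (1 - limn (series cpowd)).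
  apply: (mulIf D0); rewrite mulfVK//.
  by rewrite mulrBr mulr1 {1}GE addrK.
by rewrite expr2; ring.
Qed.
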